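(* Let $\tau$ be a $\Lambda$-acceptable sequence. Then the shift map $\sigma:\mathcal{D}_\tau\to\mathcal{D}_\tau$ has shadowing; that is, for every $\varepsilon>0$ there is a $\delta>0$ such that for every finite or infinite $\delta$ pseudo-orbit $\{x_i\}$ of $\sigma$ in $\mathcal{D}_\tau$ there is a point $z\in\mathcal{D}_\tau$ with $d(\sigma^i(z),x_i)<\varepsilon$ for all $i$ (for which $x_i$ is defined).
   Context: Let $\omega=\{0,1,2,\dots\}$. Give $\{0,1,*\}$ the non-Hausdorff topology with basis $\{\{0\},\{1\},\{0,1,*\}\}$, and let $\Lambda=\{0,1,*\}^\omega$ with the product topology. Let $\sigma$ be the shift map, $\sigma(x_0x_1x_2\dots)=x_1x_2\dots$. A sequence $\tau=\tau_0\tau_1\dots\in\Lambda$ is $\Lambda$-acceptable if: (1) for all $n\in\omega$, $\tau_n=*$ if and only if $\sigma^{n+1}(\tau)=\tau$; and (2) for all $n\in\omega$ with $\sigma^n(\tau)\neq\tau$ there is $m\in\omega$ such that $*\neq\tau_{m+n}\neq\tau_m\neq *$. Given a $\Lambda$-acceptable $\tau$, a sequence $\alpha\in\Lambda$ is $(\Lambda,\tau)$-consistent if for all $n\in\omega$, $\alpha_n=*$ implies $\sigma^{n+1}(\alpha)=\tau$. It is $(\Lambda,\tau)$-admissible if it is $(\Lambda,\tau)$-consistent and for all $n\in\omega$ with $\sigma^n(\alpha)\neq *\tau$ there is some $m>0$ such that $*\neq\alpha_{m+n}\neq\tau_{m-1}\neq *$. Here $*\tau$ is the sequence $*\tau_0\tau_1\dots$.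 $\mathcal{D}_\tau$ is the set of all $(\Lambda,\tau)$-admissible sequences, with the subspace topology from $\Lambda$. It is known (Baldwin) that $\mathcal{D}_\tau$ is a shift-invariant self-similar dendrite (a locally connected, uniquely arcwise connected compact metrizable space). It carries a natural arc-length (taxicab) metric $d$ compatible with this topology; since the space is compact, the notion of shadowing does not depend on which compatible metric is used. For a continuous map $f$ on a metric space $(X,d)$, a $\delta$ pseudo-orbit is a finite or infinite sequence $\{x_i\}$ in $X$, starting at index $i=0$, with $d(f(x_i),x_{i+1})<\delta$ for all $i$ for which $x_{i+1}$ is defined. *)

(* Defs.v *)
From HB Require Import structures.
From mathcomp Require Import all_boot all_order all_algebra.
From mathcomp Require Import all_classical all_reals all_analysis.

Set Implicit Arguments.
Unset Strict Implicit.
Unset Printing Implicit Defensive.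

Import Order.TTheory GRing.Theory Num.Theory.
Local Open Scope classical_set_scope.
Local Open Scope ring_scope.

Inductive symbol := Zero | One | Star.

Definition option_of_symbol (s : symbol) : option bool :=
  match s with Zero => Some false | One => Some true | Star => None end.

Definition symbol_of_option (o : option bool) : symbol :=
  match o with Some false => Zero | Some true => One | None => Star end.

Lemma option_of_symbolK : cancel option_of_symbol symbol_of_option.
Proof. by case. Qed.

HB.instance Definition _ := Countable.copy symbol (can_type option_of_symbolK).

(* The basis {0}, {1}, {0,1,*}: the index [option_of_symbol s] gives the least
   basic open set containing [s]. *)
Definition symbol_basis (o : option bool) : set symbol :=
  match o with
  | Some false => [set Zero]
  | Some true => [set One]
  | None => setT
  end.

Lemma symbol_basis_cover : \bigcup_(o in setT) symbol_basis o = setT.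
Proof. by apply/seteqP; split=> // s _; exists None. Qed.

Lemma symbol_basis_join (i j : option bool) (s : symbol) :
  setT i -> setT j -> symbol_basis i s -> symbol_basis j s ->
  exists k, [/\ setT k, symbol_basis k s &
                symbol_basis k `<=` symbol_basis i `&` symbol_basis j].
Proof.
move=> _ _ si sj; exists (option_of_symbol s); split=> //.
  by case: s {si sj}.
by move: i j si sj => [[]|] [[]|]; case: s => //= _ _ t ->.
Qed.

HB.instance Definition _ := isBaseTopological.Build symbol
  symbol_basis_cover symbol_basis_join.

Definition Lambda := prod_topology (fun _ : nat => symbol).
HB.instance Definition _ := Topological.on Lambda.

Definition seq_shift (x : Lambda) : Lambda := fun n => x n.+1.

Definition cons_star (x : Lambda) : Lambda :=
  fun n => if n is k.+1 then x k else Star.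

Definition acceptable (tau : Lambda) : Prop :=
  (forall n, tau n = Star <-> iter n.+1 seq_shift tau = tau) /\
  (forall n, iter n seq_shift tau <> tau ->
     exists m, [/\ Star <> tau (m + n)%N, tau (m + n)%N <> tau m
                 & tau m <> Star]).

Definition consistent (tau alpha : Lambda) : Prop :=
  forall n, alpha n = Star -> iter n.+1 seq_shift alpha = tau.

Definition admissible (tau alpha : Lambda) : Prop :=
  consistent tau alpha /\
  (forall n, iter n seq_shift alpha <> cons_star tau ->
     exists m, [/\ (0 < m)%N, Star <> alpha (m + n)%N,
                   alpha (m + n)%N <> tau m.-1 & tau m.-1 <> Star]).

Definition dendrite (tau : Lambda) : set Lambda := 
  [set alpha | admissible tau alpha].

Lemma shift_admissible (tau alpha : Lambda) :
  alpha \in dendrite tau -> seq_shift alpha \in dendrite tau.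
Proof.
rewrite !inE => -[cons adm]; split=> n.
  by move=> /cons; rewrite iterSr.
rewrite -iterSr => /adm [m [m0 a b c]]; exists m.
by split=> //; rewrite /seq_shift -addnS.
Qed.

(* As a type, [dendrite tau] is [set_type (dendrite tau)], which carries the
   initial topology of its inclusion into [Lambda], i.e. the subspace topology. *)
Definition dendrite_shift (tau : Lambda) (x : dendrite tau) : dendrite tau :=
  exist _ (seq_shift (sval x)) (shift_admissible (svalP x)).

Record compatible_metric (R : realType) (T : topologicalType)
    (d : T -> T -> R) : Prop := CompatibleMetric {
  metric_eq0 : forall x y, d x y = 0 <-> x = y ;
  metric_symmetric : forall x y, d x y = d y x ;
  metric_triangle : forall x y z, d x z <= d x y + d y z ;
  metric_nbhs : forall (x : T) (A : set T),
    nbhs x A <-> exists2 e, 0 < e & [set y | d x y < e] `<=` A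
}.

(* A finite or infinite sequence is a function [x : nat -> T] together with
   [final : option nat]: [Some N] stands for x_0, ..., x_N (values beyond N are
   irrelevant), [None] for an infinite sequence. *)
Definition in_range (final : option nat) (i : nat) : Prop :=
  if final is Some N then (i <= N)%N else True.

Definition pseudo_orbit (R : realType) (T : Type) (d : T -> T -> R)
    (f : T -> T) (delta : R) (final : option nat) (x : nat -> T) : Prop :=
  forall i, in_range final i.+1 -> d (f (x i)) (x i.+1) < delta.

Definition has_shadowing (R : realType) (T : Type) (d : T -> T -> R)
    (f : T -> T) : Prop :=
  forall eps : R, 0 < eps -> exists2 delta : R, 0 < delta &
    forall (final : option nat) (x : nat -> T),
      pseudo_orbit d f delta final x ->
      exists z : T, forall i, in_range final i -> d (iter i f z) (x i) < eps.

(* Main.v *)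
(* Every binary sequence z refines exactly one point of the dendrite, obtained
   by replacing z_i with * whenever the tail of z after position i refines tau.
   This gives a continuous surjection pi from Cantor space onto the dendrite
   which commutes with the shifts. If pi(u_0), pi(u_1), ... is an orbit, then the
   diagonal sequence of the zeroth digits of u_0, u_1, ... again lifts pi(u_0).
   By compactness of the space of families (u_i), for a pseudo-orbit pi(u_i) with
   small error, pi(diagonal) is close to pi(u_0); applying this to all the tails
   of the pseudo-orbit shows that pi(diagonal) shadows it. *)
Require Import Defs.
From mathcomp Require Import all_boot all_order all_algebra.
From mathcomp Require Import all_classical all_reals all_analysis.
From mathcomp Require Import lra.

Set Implicit Arguments.
Unset Strict Implicit.
Unset Printing Implicit Defensive.

Import Order.TTheory GRing.Theory Num.Theory.
Import numFieldNormedType.Exports.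
Local Open Scope classical_set_scope.
Local Open Scope ring_scope.

(** * Compatibility of sequences with stars *)

Lemma iter_seq_shiftE (n : nat) (x : Lambda) (m : nat) :
  iter n seq_shift x m = x (n + m)%N.
Proof. by elim: n m => // n IH m; rewrite iterS /seq_shift IH addnS. Qed.

(** [Star] counts as an undefined value, so this is compatibility of partial binary sequences, which
    is not transitive. *)
Definition agree (x y : Lambda) :=
  forall i, x i <> Star -> y i <> Star -> x i = y i.

Lemma acceptable_agree (tau : Lambda) (n : nat) : acceptable tau ->
  agree (iter n seq_shift tau) tau -> iter n seq_shift tau = tau.
Proof.
move=> [_ acc] agr; apply: contrapT => /acc[m [nS neq mS]]; apply: neq.
by move: (agr m); rewrite iter_seq_shiftE addnC; apply=> // /esym.
Qed.

Lemma acceptable_star (tau : Lambda) (n : nat) : acceptable tau ->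
  agree (iter n.+1 seq_shift tau) tau -> tau n = Star.
Proof. by move=> acc /(acceptable_agree acc) E; apply/acc.1. Qed.

Lemma admissible_agree (tau alpha : Lambda) (n : nat) : admissible tau alpha ->
  agree (iter n.+1 seq_shift alpha) tau -> alpha n = Star.
Proof.
move=> [_ adm] agr; have [E|] := pselect (iter n seq_shift alpha = cons_star tau).
  by rewrite -[n in LHS]addn0 -iter_seq_shiftE E.
move=> /adm[[|m] [//= _ nS neq mS]]; exfalso; apply: neq.
by move: (agr m); rewrite iter_seq_shiftE /= addSn addnC -addSn; apply=> // /esym.
Qed.

(** If no [m] separates at [n], the tail after [n] agrees with [tau]. This forces a star at [n], and
    consistency then turns the tail from [n] on into [cons_star tau]. *)
Lemma agree_admissible (tau alpha : Lambda) : consistent tau alpha ->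
  (forall n, agree (iter n.+1 seq_shift alpha) tau -> alpha n = Star) ->
  admissible tau alpha.
Proof.
move=> cons agr; split=> // n neq; apply: contrapT => nex; apply: neq.
have nS : alpha n = Star.
  apply: agr => i; rewrite iter_seq_shiftE => aS tS; apply: contrapT => neq.
  by apply: nex; exists i.+1; rewrite /= addSn addnC -addSn; split=> // /esym.
apply/funext => -[|m]; rewrite iter_seq_shiftE ?addn0 //=.
by rewrite -(cons _ nS) iter_seq_shiftE addSnnS.
Qed.

(** * Binary refinements and continuity in products *)

Definition bit (b : bool) : symbol := if b then One else Zero.

Definition refines (z : nat -> bool) (x : Lambda) :=
  forall i, x i <> Star -> x i = bit (z i).

Definition tail (n : nat) (z : nat -> bool) : nat -> bool := fun i => z (n + i)%N.

Lemma tailD (m n : nat) (z : nat -> bool) : tail m (tail n z) = tail (n + m)%N z.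
Proof. by apply/funext => i; rewrite /tail addnA. Qed.

Lemma refines_tail (z : nat -> bool) (x : Lambda) (n : nat) :
  refines z x -> refines (tail n z) (iter n seq_shift x).
Proof. by move=> zx i; rewrite iter_seq_shiftE => /zx. Qed.

Lemma refines_agree (z : nat -> bool) (x y : Lambda) :
  refines z x -> refines z y -> agree x y.
Proof. by move=> zx zy i /zx-> /zy->. Qed.

Lemma bit_neq_Star (b : bool) : bit b <> Star. Proof. by case: b. Qed.

Lemma continuous_prod (X : topologicalType) (I : Type) (T : I -> topologicalType)
    (f : X -> prod_topology T) :
  (forall i, continuous (fun x => f x i)) -> continuous f.
Proof.
move=> cf x; apply/cvg_sup => i.
exact: (@continuous_comp_initial _ _ _ (fun g : prod_topology T => g i)).
Qed.

Lemma near_bit (z : cantor_space) (i : nat) : \forall z' \near z, z' i = z i.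
Proof.
apply: (@proj_continuous nat (fun=> bool) i z [set b | b = z i]).
by rewrite nbhs_principalE.
Qed.

Lemma reindex_continuous (a b : nat -> nat) :
  continuous ((fun u k => u (a k) (b k)) :
    prod_topology (fun _ : nat => cantor_space) -> cantor_space).
Proof.
apply: continuous_prod => k u.
move=> A /(@proj_continuous nat (fun=> bool) (b k) (u (a k))).
exact: (@proj_continuous nat (fun=> cantor_space) (a k) u).
Qed.

(** * The projection of Cantor space onto the dendrite *)

Section projection.
Variables (tau : Lambda) (htau : acceptable tau).

(** After a star of one sequence its tail is [tau], so the same tail of the other agrees with [tau]
    and admissibility puts a star there too. Hence the stars coincide. *)
Lemma agree_admissible_eq (x y : Lambda) :
  admissible tau x -> admissible tau y -> agree x y -> x = y.
Proof.
move=> Ax Ay agr.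
have star u v : admissible tau u -> admissible tau v -> agree u v ->
    forall i, u i = Star -> v i = Star.
  move=> [Cu _] Av uv i uS; apply: (admissible_agree Av) => j.
  rewrite -(Cu _ uS) !iter_seq_shiftE => vj uj; exact/esym/uv.
have agr' : agree y x by move=> i yi xi; exact/esym/agr.
apply/funext => i; have [xS|xS] := eqVneq (x i) Star.
  by rewrite xS (star x y).
have [yS|yS] := eqVneq (y i) Star; first by rewrite yS (star y x).
by apply: agr; apply/eqP.
Qed.

Definition reduce (z : nat -> bool) : Lambda :=
  fun i => if `[< refines (tail i.+1 z) tau >] then Star else bit (z i).

Lemma refines_reduce (z : nat -> bool) : refines z (reduce z).
Proof. by move=> i; rewrite /reduce; case: ifP. Qed.

Lemma reduce_star (z : nat -> bool) (i : nat) :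
  reduce z i = Star -> refines (tail i.+1 z) tau.
Proof. by rewrite /reduce; case: asboolP => // _ /bit_neq_Star. Qed.

Lemma reduce_consistent (z : nat -> bool) : consistent tau (reduce z).
Proof.
move=> n /reduce_star ref; apply/funext => j; rewrite iter_seq_shiftE.
have tl : tail (n.+1 + j).+1 z = tail j.+1 (tail n.+1 z) by rewrite tailD addnS.
(* A star of [reduce z] at this place means that one binary sequence refines both [tau] and a shift
   of [tau]. Conversely, a star of [tau] at [j] makes [tau] periodic, so the later tail of [z]
   refines [tau] as well. *)
rewrite /reduce tl; case: asboolP => [ref'|nref].
  apply/esym/(acceptable_star htau).
  by apply: refines_agree ref'; exact: refines_tail.
apply/esym/ref => tS; apply: nref; have /htau.1 <- := tS.
exact: refines_tail.
Qed.

Lemma reduce_admissible (z : nat -> bool) : admissible tau (reduce z).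
Proof.
apply: agree_admissible => [|n agr]; first exact: reduce_consistent.
rewrite /reduce asboolT // => j tS.
have [bS|/eqP bS] := eqVneq (reduce z (n.+1 + j)%N) Star; last first.
  rewrite -agr ?iter_seq_shiftE //; exact: refines_reduce.
(* The star [bS] is followed by a copy of [tau], so [agr] compares [tau] with its own shift by
   [j.+1]. *)
exfalso; apply: tS; apply: (acceptable_star htau) => i.
have tE : tau i = iter n.+1 seq_shift (reduce z) (j.+1 + i)%N.
  by rewrite -[in LHS](reduce_consistent bS) !iter_seq_shiftE -addnS addnA.
by rewrite iter_seq_shiftE tE => tS' bS'; apply/esym/agr.
Qed.

Definition project (z : cantor_space) : dendrite tau :=
  exist _ (reduce z) (mem_set (reduce_admissible z)).

Lemma sval_admissible (x : dendrite tau) : admissible tau (sval x).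
Proof. exact: set_mem (svalP x). Qed.

Lemma refines_project (z : cantor_space) (x : dendrite tau) :
  refines z (sval x) -> project z = x.
Proof.
move=> zx; apply: val_inj; apply: agree_admissible_eq.
- exact: sval_admissible.
- exact: sval_admissible.
- exact: (refines_agree (@refines_reduce z) zx).
Qed.

Lemma sval_iter_shift (n : nat) (x : dendrite tau) :
  sval (iter n (@dendrite_shift tau) x) = iter n seq_shift (sval x).
Proof. by elim: n => //= n ->. Qed.

Lemma project_tail (n : nat) (z : cantor_space) :
  project (tail n z) = iter n (@dendrite_shift tau) (project z).
Proof.
apply: refines_project; rewrite sval_iter_shift.
exact: (refines_tail (@refines_reduce z)).
Qed.

Lemma project_surj (x : dendrite tau) : exists z, project z = x.
Proof.
exists (fun i => if sval x i is One then true else false).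
by apply: refines_project => i; case: (sval x i).
Qed.

(** Along an orbit, digit [i] of the first point is digit 0 of the [i]-th point, which [u i]
    refines. *)
Lemma project_diag (u : nat -> cantor_space) :
  (forall i, dendrite_shift (project (u i)) = project (u i.+1)) ->
  project (fun i => u i 0%N) = project (u 0%N).
Proof.
move=> orb; have orbE i : project (u i) = iter i (@dendrite_shift tau) (project (u 0%N)).
  by elim: i => //= i <-.
apply: refines_project => i xS.
have xE : sval (project (u 0%N)) i = sval (project (u i)) 0%N.
  by rewrite (orbE i) sval_iter_shift iter_seq_shiftE addn0.
by move: xS; rewrite xE; apply: refines_reduce.
Qed.

Lemma nbhs_Star (A : set symbol) : nbhs Star A -> A = setT.
Proof.
rewrite nbhsE => -[B [[E _ <-] [i Ei iS]] BA]; apply/seteqP; split=> // s _.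
by apply: BA; exists i => //; case: i iS {Ei} => [[]|].
Qed.

Lemma project_continuous : continuous project.
Proof.
apply: (@continuous_comp_initial _ cantor_space Lambda set_val).
apply: continuous_prod => i.
change (continuous (fun z : cantor_space => reduce z i)) => z A.
have [zS|/eqP zS] := eqVneq (reduce z i) Star.
  by rewrite zS => /nbhs_Star ->; exact: filterT.
move=> /nbhs_singleton /= Az.
have : ~ refines (tail i.+1 z) tau by move: zS; rewrite /reduce; case: asboolP.
(* Failure to refine [tau] is witnessed by the single coordinate [j], so it persists near [z]. *)
move=> /existsNP[j /not_implyP[tS neq]].
suff : \forall z' \near z, reduce z' i = reduce z i.
  by apply: filterS => z' /= ->.
near=> z'.
rewrite /reduce !asboolF.
- by congr bit; near: z'; exact: near_bit.
- by move=> /(_ j tS).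
- move=> /(_ j tS); rewrite /tail (_ : z' (i.+1 + j)%N = z (i.+1 + j)%N) //.
  by near: z'; exact: near_bit.
Unshelve. all: by end_near. Qed.

End projection.

(** * Compactness and shadowing *)

Theorem theorem4p2 (R : realType) (tau : Lambda) (htau : acceptable tau)
    (d : dendrite tau -> dendrite tau -> R) (hd : compatible_metric d) :
  has_shadowing d (@dendrite_shift tau).
Proof.
have [d0 dC dtri dnbhs] := hd.
have dxx x : d x x = 0 by apply/d0.
have dge0 x y : 0 <= d x y by have := dtri x y x; rewrite dxx (dC y x); lra.
pose X := prod_topology (fun _ : nat => cantor_space).
pose pr (a b : nat -> nat) (u : X) := project htau (fun k => u (a k) (b k)).
have near_pr a b u e : 0 < e -> \forall u' \near u, d (pr a b u) (pr a b u') < e.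
  move=> e0.
  have pr_cont : continuous (pr a b).
    move=> v; apply: (@continuous_comp X cantor_space _ _ (project htau)).
      exact: reindex_continuous.
    exact: project_continuous.
  by apply: (pr_cont u [set y | d (pr a b u) y < e]); apply/dnbhs; exists e.
have dist_cont a b a' b' : continuous (fun u => d (pr a b u) (pr a' b' u) : R).
  move=> u; apply/cvgrPdist_lt => e e0; have e20 : 0 < e / 2 by rewrite divr_gt0.
  near=> u'.
  have : d (pr a b u) (pr a b u') < e / 2 by near: u'; exact: near_pr.
  have : d (pr a' b' u) (pr a' b' u') < e / 2 by near: u'; exact: near_pr.
  have := dtri (pr a b u) (pr a b u') (pr a' b' u).
  have := dtri (pr a b u') (pr a' b' u') (pr a' b' u).
  have := dtri (pr a b u') (pr a b u) (pr a' b' u').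
  have := dtri (pr a b u) (pr a' b' u) (pr a' b' u').
  rewrite (dC (pr a' b' u') (pr a' b' u)) (dC (pr a b u') (pr a b u)) ltr_norml.
  by move=> *; apply/andP; split; lra.
pose step i := pr (fun=> i) S.
pose point i := pr (fun=> i) id.
pose diag := pr id (fun=> 0%N).
have stepE i u : step i u = dendrite_shift (project htau (u i)).
  exact: (project_tail htau 1).
move=> eps eps0.
have cX : compact [set: X].
  have := @tychonoff nat (fun=> cantor_space) _ (fun=> cantor_space_compact).
  by congr (compact _); apply/seteqP; split.
(* The bound is shown for all small [delta > 0]. Compactness, as near covering, reduces this to the
   implication for [u'] near each [u] and [delta] near 0. *)
have [] := @filter_ex _ (0^'+ : set_system R) _ (fun delta => 0 < delta /\
    forall u : X, (forall i, d (step i u) (point i.+1 u) < delta) ->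
      d (diag u) (point 0%N u) < eps).
  apply: filterI; first exact: nbhs_right_gt.
  have /compact_near_coveringP/(_ _ (0^'+ : set_system R)
    (fun delta u => (forall i, d (step i u) (point i.+1 u) < delta) ->
      d (diag u) (point 0%N u) < eps)) := cX.
  move=> cov; near=> delta.
    suff : [set: X] `<=` [set u | (forall i, d (step i u) (point i.+1 u) < delta) ->
      d (diag u) (point 0%N u) < eps] by move=> + u; exact.
    near: delta; apply: cov => u _.
    have [orb|] := pselect (forall i, step i u = point i.+1 u).
      have near_u : d (diag u) (point 0%N u) < eps.
        rewrite (_ : diag u = point 0%N u) ?dxx //.
        by apply: project_diag => i; rewrite -stepE.
      exists ([set u' | d (diag u') (point 0%N u') < eps], setT).
        by split; [exact: (cvgr_lt _ (dist_cont _ _ _ _ u) _ near_u)|exact: filterT].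
      by move=> -[u' delta] [].
    (* Some step has a positive error; near [u] it stays above half of that, so the hypothesis fails
       for smaller [delta]. *)
    move=> /existsNP[i neq].
    have r0 : 0 < d (step i u) (point i.+1 u).
      by rewrite lt_neqAle eq_sym dge0 andbT; apply/eqP => /d0.
    have r1 : d (step i u) (point i.+1 u) / 2 < d (step i u) (point i.+1 u) by lra.
    exists ([set u' | d (step i u) (point i.+1 u) / 2 < d (step i u') (point i.+1 u')],
            [set delta | delta < d (step i u) (point i.+1 u) / 2]).
      split; last by apply: nbhs_right_lt; rewrite divr_gt0.
      exact: (cvgr_gt _ (dist_cont _ _ _ _ u) _ r1).
    move=> -[u' delta'] /= [far small] /(_ i) near_u'.
    by have := lt_trans near_u' (lt_trans small far); rewrite ltxx.
move=> delta [delta0 shadow]; exists delta => // final x px.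
have [y yx yp] : exists2 y : nat -> dendrite tau,
    (forall i, in_range final i -> y i = x i) &
    forall i, d (dendrite_shift (y i)) (y i.+1) < delta.
  case: final px => [N|] px; last by exists x => // i; exact: px.
  (* A finite pseudo-orbit is continued by the true orbit of its last point; [i - N] is 0 up to
     [N]. *)
  exists (fun i => iter (i - N) (@dendrite_shift tau) (x (minn i N))) => [i iN|i].
    by rewrite (eqP iN) (minn_idPl iN).
  have [iN|Ni] := ltnP i N.
    have iN' := ltnW iN.
    by rewrite (eqP iN) (eqP iN') (minn_idPl iN); exact: px.
  by rewrite subSn // (minn_idPr (leqW Ni)) iterS dxx.
have [u uy] := choice (fun i => project_surj htau (y i)).
exists (diag u) => i /yx <-.
(* Shifting the diagonal point amounts to dropping the first [i] members of the family. *)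
have -> : iter i (@dendrite_shift tau) (diag u) = diag (fun k => u (i + k)%N).
  by rewrite -project_tail.
have := shadow (fun k => u (i + k)%N); rewrite /point /pr addn0 -uy; apply => k.
by rewrite stepE addnS !uy.
Unshelve. all: by end_near. Qed.
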